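(* Let $\tilde p<0$ be an integer and $\tilde q$ a positive integer with $\tilde q\geqslant 97|\tilde p|$. Put $A=\tilde q^{2}+5\tilde p\tilde q+10\tilde p^{2}$, let $p=\tilde p+\tilde q$ and $q=\tilde q$. Then there is no integer $t$ with $A<t<A+\dfrac{74|\tilde p|^3}{\tilde q}$ producing a perfect cuboid, i.e. no such integer $t$ satisfies all of the inequalities $$t>p^2,\qquad t>pq,\qquad t>q^2,\qquad (p^2+t)(pq+t)>2t^2.$$
   Context: A perfect cuboid is a rectangular parallelepiped whose edges, face diagonals and space diagonal all have integer lengths. By a previously established criterion, a triple of positive integers $p,q,t$ with $p\neq q$ coprime satisfying $Q_{pq}(t)=0$, where $Q_{pq}(t)=t^{10}+(2q^2+p^2)(3q^2-2p^2)t^8+(q^8+10p^2q^6+4p^4q^4-14p^6q^2+p^8)t^6-p^2q^2(q^8-14p^2q^6+4p^4q^4+10p^6q^2+p^8)t^4-p^6q^6(q^2+2p^2)(3p^2-2q^2)t^2-q^{10}p^{10}$, produces a perfect cuboid if and only if $t>p^2$, $t>pq$, $t>q^2$ and $(p^2+t)(pq+t)>2t^2$. *)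

(* Defs.v *)
From mathcomp Require Export all_boot all_order all_algebra.
Export Order.TTheory GRing.Theory Num.Theory.

Open Scope ring_scope.

(* Criterion under which a positive integer root t of the tenth-degree cuboid
   polynomial with coprime positive parameters p <> q yields a perfect cuboid. *)
Definition cuboid_inequalities (p q t : int) : Prop :=
  [/\ t > p ^+ 2, t > p * q, t > q ^+ 2
    & (p ^+ 2 + t) * (p * q + t) > 2 * t ^+ 2].

(* Main.v *)
Require Import Defs.
From mathcomp Require Import all_boot all_order all_algebra.
From mathcomp Require Import ring lra.
Local Open Scope ring_scope.

(** With [a = - pt > 0], the upper end of the interval is
    [q^2 - 5 a q + 10 a^2 + 74 a^3 / q]. Since [q >= 97 a], the term [5 a q]
    outweighs the last two, so this end lies below [q^2], and no [t] in the
    interval satisfies [t > q^2]. *)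

Lemma interval_end_le_sqr {F : realFieldType} (a q : F) :
    0 < a -> 97 * a <= q ->
  q ^+ 2 - 5 * a * q + 10 * a ^+ 2 + 74 * a ^+ 3 / q <= q ^+ 2.
Proof.
move=> a_gt0 le_aq; have q_gt0 : 0 < q by lra.
(* Clearing [q] and cancelling [a ^+ 2] leaves [74 * a <= q], which is weaker than [97 * a <= q]. *)
have end_le : 74 * a ^+ 3 / q <= a ^+ 2.
  by rewrite ler_pdivrMr // exprSr [74 * _]mulrC -mulrA ler_pM2l ?exprn_gt0 //; lra.
(* This gives [5 * a * q >= 485 * a ^+ 2], whereas the two positive correction terms add up to at
   most [11 * a ^+ 2]. *)
have : a * (97 * a) <= a * q by rewrite ler_pM2l.
by move: (sqr_ge0 a); lra.
Qed.

Theorem theorem8p1 (pt qt : int) (hp : pt < 0) (hq : 0 < qt)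
    (hqp : 97 * `|pt| <= qt) :
  let A : int := qt ^+ 2 + 5 * pt * qt + 10 * pt ^+ 2 in
  let p : int := pt + qt in
  let q : int := qt in
  ~ exists t : int,
      [/\ A < t,
          t%:Q < A%:Q + 74 * (`|pt| ^+ 3)%:Q / qt%:Q
        & cuboid_inequalities p q t].
Proof.
move=> A p q [t [_ t_lt [_ _ t_gt _]]].
(* The clash is between [t > q ^+ 2] and the upper bound on [t]; everything is moved to [rat], where
   the quotient by [qt] lives. *)
have a_gt0 : 0 < (- pt)%:~R :> rat by rewrite ltr0z oppr_gt0.
have le_aq : 97 * (- pt)%:~R <= qt%:~R :> rat.
  by have := hqp; rewrite (ltr0_norm hp) -(ler_int rat) intrM rmorph_nat.
have end_le := interval_end_le_sqr _ _ a_gt0 le_aq.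
have {}t_gt : qt%:~R ^+ 2 < t%:~R :> rat by rewrite -rmorphXn ltr_int.
(* Written in [a = - pt], the upper bound on [t] takes the form bounded by [end_le]. *)
have AE : A%:~R = qt%:~R ^+ 2 - 5 * (- pt)%:~R * qt%:~R
    + 10 * (- pt)%:~R ^+ 2 :> rat by rewrite /A; ring.
move: t_lt; rewrite AE (ltr0_norm hp) rmorphXn => t_lt.
by have := lt_trans t_gt (lt_le_trans t_lt end_le); rewrite ltxx.
Qed.
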